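(* Let $n\ge 2$ and let $A\subset S^n=\{x\in\mathbb R^{n+1}:\|x\|=1\}$ be a closed subset with $0<\mathrm{diam}(A)\le 1$ (diameter with respect to the Euclidean metric). Then there is an isometry $f\in\mathsf{SO}(n+1)$ such that the family $\{A,f(A),f^2(A)\}$ is linked but not centered, i.e. any two of $A,f(A),f^2(A)$ intersect but $A\cap f(A)\cap f^2(A)=\emptyset$.
   Context: $\mathsf{SO}(n+1)$ denotes the group of orientation-preserving linear isometries of $\mathbb R^{n+1}$. A family of sets is linked if any two members intersect, and centered if every finite subfamily has nonempty intersection. *)

(* Defs.v *)
From HB Require Import structures.
From mathcomp Require Import all_boot all_order all_algebra.
From mathcomp Require Import all_classical all_reals all_analysis.
Set Implicit Arguments. Unset Strict Implicit. Unset Printing Implicit Defensive.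
Import Order.TTheory GRing.Theory Num.Theory.
Import numFieldNormedType.Exports.
Local Open Scope ring_scope.
Local Open Scope classical_set_scope.

Definition enorm (R : realType) (k : nat) (x : 'rV[R]_k) : R :=
  Num.sqrt (\sum_(i < k) (x ord0 i) ^+ 2).

Definition edist (R : realType) (k : nat) (x y : 'rV[R]_k) : R :=
  enorm (x - y).

Definition sphere (R : realType) (n : nat) : set 'rV[R]_n.+1 :=
  [set x | enorm x = 1].

(* Euclidean diameter, as an extended real (empty set has diameter -oo). *)
Definition ediam (R : realType) (k : nat) (A : set 'rV[R]_k) : \bar R :=
  ereal_sup [set (edist x y)%:E | x in A & y in A].

Definition SO (R : realType) (k : nat) : set 'M[R]_k :=
  [set M | M *m M^T = 1%:M /\ \det M = 1].

Definition act (R : realType) (k : nat) (M : 'M[R]_k) (A : set 'rV[R]_k)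
  : set 'rV[R]_k := (fun x => x *m M) @` A.

(* Main.v *)
(** Let [f] be a rotation of order 3 with [f p = q], [p] and [q] distinct points
    of [A]; then [A], [f A], [f^2 A] are linked.  A common point would give an
    orbit [x, f x, f^2 x] inside [A]; its sum is orthogonal to the plane of
    rotation, which is impossible if that plane contains a vector having
    positive inner product with every point of [A].  Such a plane is found from
    a vector [w] orthogonal to [p] and nonnegative on [A] for which
    [w.q < |w| |p - q| / 2], i.e. an almost supporting direction at the edge
    [pq]: adding to [w] a positive multiple of [p + q], which is positive on [A]
    by the diameter bound, tilts the plane through [p - q] until the rotation
    angle from [p] to [q] is 120 degrees.  To get [w], take [p] farthest from
    some point of [A], so that [A] has a supporting vector [h] at [p], and turn
    [h] around [p] towards [-h] until nonnegativity on [A] fails. *)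
Require Import Defs.
From HB Require Import structures.
From mathcomp Require Import all_boot all_order all_algebra.
From mathcomp Require Import all_classical all_reals all_analysis.
From mathcomp Require Import ring lra.
Set Implicit Arguments.
Unset Strict Implicit.
Unset Printing Implicit Defensive.
Import Order.TTheory GRing.Theory Num.Theory.
Import numFieldNormedType.Exports.
Local Open Scope ring_scope.
Local Open Scope classical_set_scope.

(** * Euclidean inner product *)

Definition dot {R : realType} {k : nat} (x y : 'rV[R]_k) : R :=
  \sum_(i < k) x ord0 i * y ord0 i.

Section Dot.
Variables (R : realType) (k : nat).
Implicit Types (x y z : 'rV[R]_k) (c : R).

Lemma dotC x y : dot x y = dot y x.
Proof. by apply: eq_bigr => i _; rewrite mulrC. Qed.

Lemma dotDl x y z : dot (x + y) z = dot x z + dot y z.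
Proof. by rewrite -big_split; apply: eq_bigr => i _; rewrite mxE mulrDl. Qed.

Lemma dotZl c x y : dot (c *: x) y = c * dot x y.
Proof. by rewrite /dot mulr_sumr; apply: eq_bigr => i _; rewrite mxE mulrA. Qed.

Lemma dotNl x y : dot (- x) y = - dot x y.
Proof. by rewrite -scaleN1r dotZl mulN1r. Qed.

Lemma dotDr x y z : dot x (y + z) = dot x y + dot x z.
Proof. by rewrite dotC dotDl !(dotC x). Qed.

Lemma dotZr c x y : dot x (c *: y) = c * dot x y.
Proof. by rewrite dotC dotZl dotC. Qed.

Lemma dotNr x y : dot x (- y) = - dot x y.
Proof. by rewrite dotC dotNl dotC. Qed.

Definition dotE := (dotDl, dotDr, dotNl, dotNr, dotZl, dotZr).

Lemma dot_ge0 x : 0 <= dot x x.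
Proof. by apply: sumr_ge0 => i _; rewrite -expr2 sqr_ge0. Qed.

Lemma dot_eq0 x : (dot x x == 0) = (x == 0).
Proof.
apply/idP/eqP => [|->]; last by rewrite /dot big1 // => i _; rewrite mxE mul0r.
rewrite /dot psumr_eq0 => [/allP x0|i _]; last by rewrite -expr2 sqr_ge0.
apply/rowP => i; apply/eqP; rewrite mxE.
by have /= := x0 i (mem_index_enum i); rewrite mulf_eq0 orbb.
Qed.

Lemma dot_gt0 x : x != 0 -> 0 < dot x x.
Proof. by move=> x0; rewrite lt_neqAle eq_sym dot_eq0 x0 dot_ge0. Qed.

Lemma dot_CauchySchwarz x y : dot x y ^+ 2 <= dot x x * dot y y.
Proof.
have [->|y0] := eqVneq y 0.
  by rewrite -[0](scale0r 0) !dotZr !mul0r mulr0 expr0n.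
have := dot_ge0 (dot y y *: x - dot x y *: y); rewrite !dotE (dotC y x).
rewrite [leRHS](_ : _ = dot y y * (dot x x * dot y y - dot x y ^+ 2)); last ring.
by rewrite pmulr_rge0 ?dot_gt0// subr_ge0.
Qed.

Lemma dot_mulmx x y z : x *m (y^T *m z) = dot x y *: z.
Proof.
rewrite mulmxA [x *m y^T]mx11_scalar mul_scalar_mx; congr (_ *: z).
by rewrite mxE; apply: eq_bigr => i _; rewrite mxE.
Qed.

Lemma enormE x : enorm x = Num.sqrt (dot x x).
Proof. by congr Num.sqrt; apply: eq_bigr => i _; rewrite expr2. Qed.

Lemma dot_continuous x : continuous (dot x).
Proof.
rewrite /dot; apply: continuous_big => [|i _ y]; first exact: add_continuous.
exact: continuous_comp (@coord_continuous R _ _ ord0 i y) (@mulrl_continuous R _ _).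
Qed.

Lemma orthogonal_pair_exists x y : (2 < k)%N ->
  exists z, [/\ z != 0, dot z x = 0 & dot z y = 0].
Proof.
move=> k3; pose B := col_mx x y.
have /rowV0Pn [z] : kermx B^T != 0.
  rewrite kermx_eq0 -row_leq_rank -ltnNge.
  by rewrite (leq_ltn_trans _ k3)// (leq_trans (rank_leq_col _)).
rewrite sub_kermx => /eqP zB z0; exists z.
have dotB j : dot z (row j B) = 0.
  have /rowP/(_ j) := zB; rewrite !mxE => <-.
  by apply: eq_bigr => i _; rewrite !mxE.
split=> //.
- by have := dotB (lshift 1 ord0); rewrite rowKu row_id.
- by have := dotB (rshift 1 ord0); rewrite rowKd row_id.
Qed.

End Dot.

(** * Rotations of order 3 *)

Section Rotation.
Variables (R : realType) (k : nat) (a v : 'rV[R]_k).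

(* Rotation by 120 degrees in the plane spanned by [a] and [v], provided
   [a] and [v] are orthogonal and [|v|^2 = 3 |a|^2]; the ratio avoids square
   roots in the entries. *)
Definition rot : 'M[R]_k := 1%:M - (2 * dot a a)^-1 *:
  (a^T *m (3 *: a - v) + v^T *m (v + a)).

Hypotheses (a0 : a != 0) (av : dot a v = 0) (vv : dot v v = 3 * dot a a).

Lemma mulmx_rot x : x *m rot = x - (2 * dot a a)^-1 *:
  (dot x a *: (3 *: a - v) + dot x v *: (v + a)).
Proof. by rewrite mulmxBr mulmx1 -scalemxAr mulmxDr !dot_mulmx. Qed.

Lemma mulmx_trrot x : x *m rot^T = x - (2 * dot a a)^-1 *:
  (dot x a *: (3 *: a + v) + dot x v *: (v - a)).
Proof.
have -> : rot^T = 1%:M - (2 * dot a a)^-1 *: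
    (3 *: (a^T *m a) - v^T *m a + (v^T *m v + a^T *m v)).
  by apply/matrixP => i j; rewrite !mxE !big_ord1 !mxE eq_sym; ring.
rewrite mulmxBr mulmx1 -scalemxAr !mulmxDr mulmxN -scalemxAr !dot_mulmx.
congr (_ - _ *: _); apply/rowP => j; rewrite !mxE; ring.
Qed.

Let aa0 : dot a a != 0. Proof. by rewrite dot_eq0. Qed.

Lemma rot_orthogonal : rot *m rot^T = 1%:M.
Proof.
apply/row_matrixP => i; rewrite !rowE mulmxA mulmx1.
move: (delta_mx _ _) => x.
rewrite mulmx_trrot mulmx_rot !dotE (dotC v a) av vv.
by apply/rowP => j; rewrite !mxE; field.
Qed.

(** As [rot^T] is the inverse of [rot], this says that the cube of [rot] is the identity. *)
Lemma rot_square : rot *m rot = rot^T.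
Proof.
apply/row_matrixP => i; rewrite !rowE mulmxA.
move: (delta_mx _ _) => x.
rewrite mulmx_trrot !mulmx_rot !dotE (dotC v a) av vv.
by apply/rowP => j; rewrite !mxE; field.
Qed.

(** By [rot_square] the determinant is its own square, and it is nonzero. *)
Lemma det_rot : \det rot = 1.
Proof.
have d0 : \det rot != 0.
  apply/eqP => d0; have /(congr1 determinant) := rot_orthogonal.
  by rewrite det_mulmx d0 mul0r det1 => /eqP; rewrite eq_sym oner_eq0.
apply: (mulfI d0); rewrite -det_mulmx rot_square det_tr mulr1 //.
Qed.

(** The sum of the three powers of [rot] is symmetric and vanishes on the plane of [a] and [v]. *)
Lemma dot_rot_orbit c x :
  dot (v + c *: a) x + dot (v + c *: a) (x *m rot)
    + dot (v + c *: a) (x *m rot^T) = 0.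
Proof.
rewrite mulmx_trrot mulmx_rot !dotE (dotC v a) (dotC x a) (dotC x v) av vv.
by field.
Qed.

End Rotation.

(** * Almost supporting directions *)

Section Search.
Variables (R : realType) (k : nat) (A : set 'rV[R]_k) (p : 'rV[R]_k).

Definition nonneg_on (w : 'rV[R]_k) := forall x, A x -> 0 <= dot w x.

Lemma shallow_support (h g o : 'rV[R]_k) :
  dot h p = 0 -> dot g p = 0 -> dot g h = 0 -> dot g g = dot h h ->
  nonneg_on h -> A o -> 0 < dot h o ->
  exists w q, [/\ nonneg_on w, A q, dot w p = 0 &
    4 * dot w q ^+ 2 < dot w w * dot (p - q) (p - q)].
Proof.
move=> hp gp gh gg hA Ao ho; apply: contrapT => none.
(* If [w'.q < 0 <= w.q], then [(w - w').(p - q) = w'.q - w.q] exceeds [w.q] in absolute value, so by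
   Cauchy-Schwarz the pair [w], [q] contradicts [none]. *)
have step w w' : dot w p = 0 -> dot w' p = 0 ->
    4 * dot (w - w') (w - w') <= dot w w -> nonneg_on w -> nonneg_on w'.
  move=> wp w'p ww' wA q Aq; rewrite leNgt; apply/negP => w'q.
  apply: none; exists w, q; split=> //.
  have := dot_CauchySchwarz (w - w') (p - q).
  have := wA q Aq; have := dot_ge0 (p - q).
  have -> : dot (w - w') (p - q) = dot w' q - dot w q.
    by rewrite !dotE wp w'p; ring.
  move: ww'; move: (dot (w - w') _) (dot (p - q) _) => d e ww' e0 wq CS.
  apply: (@lt_le_trans _ _ (4 * (dot w' q - dot w q) ^+ 2)); first by nra.
  by nra.
have hstep s t s' t' :
    4 * ((s - s') ^+ 2 + (t - t') ^+ 2) <= s ^+ 2 + t ^+ 2 ->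
    nonneg_on (s *: h + t *: g) -> nonneg_on (s' *: h + t' *: g).
  move=> st; apply: step; rewrite !dotE ?hp ?gp ?(dotC h g) ?gh ?gg; try ring.
  have := dot_ge0 h; move: (dot h h) => H H0; nra.
(* Vertices of a half-turn from [h] to [-h] whose steps are at most half as
   long as the vector they start from. *)
suff : nonneg_on ((-4) *: h + 0 *: g).
  by move=> /(_ o Ao); rewrite !dotE; nra.
apply: (hstep (-4) 2); first by lra.
apply: (hstep (-3) 4); first by lra.
apply: (hstep (-1) 5); first by lra.
apply: (hstep 1 5); first by lra.
apply: (hstep 3 4); first by lra.
apply: (hstep 4 2); first by lra.
apply: (hstep 4 0); first by lra.
by move=> x /hA hx; rewrite !dotE; nra.
Qed.

End Search.

(** * Spherical sets of diameter at most 1 *)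

Section Sphere.
Variables (R : realType) (n : nat) (A : set 'rV[R]_n.+1).
Hypotheses (A_sphere : A `<=` @sphere R n) (A_diam : (ediam A <= 1)%E).

Lemma sphere_dot x : A x -> dot x x = 1.
Proof.
move=> /A_sphere; rewrite /sphere/= enormE => /(congr1 (fun z => z ^+ 2)).
by rewrite sqr_sqrtr ?dot_ge0// expr1n.
Qed.

Lemma diam_dot x y : A x -> A y -> 1 / 2 <= dot x y.
Proof.
move=> Ax Ay.
have : ((Defs.edist x y)%:E <= 1)%E.
  by apply: le_trans A_diam; apply: ereal_sup_ubound; exists x => //; exists y.
rewrite lee_fin /Defs.edist enormE -[leRHS]sqrtr1 ler_sqrt//.
by rewrite !dotE (dotC y x) !sphere_dot//; lra.
Qed.

(** The value of [dot p v] is the one for which [rot (p - q) v] sends [p] to [q]. *)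
Lemma rotation_plane p q w : A p -> A q -> nonneg_on A w -> dot w p = 0 ->
  4 * dot w q ^+ 2 < dot w w * dot (p - q) (p - q) ->
  exists v c, [/\ dot (p - q) v = 0, dot v v = 3 * dot (p - q) (p - q),
    dot p v = dot (p - q) (p - q) / 2 &
    forall x, A x -> 0 < dot (v + c *: (p - q)) x].
Proof.
move=> Ap Aq wA wp.
set a := p - q; set D := dot a a; set W := dot w q; set H := dot w w => shallow.
have pp := sphere_dot Ap; have qq := sphere_dot Aq.
have DE : D = 2 - 2 * dot p q.
  by rewrite /D /a !dotE pp qq (dotC q p); ring.
have pq := diam_dot Ap Aq.
have W0 : 0 <= W := wA q Aq.
have H0 : 0 <= H := dot_ge0 w.
have D0 : 0 < D by rewrite lt_neqAle dot_ge0 andbT; apply/eqP => D0; nra.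
have D1 : D <= 1 by lra.
pose M := 1 - D / 4.
have M34 : 3 / 4 <= M by rewrite /M; lra.
have WH : 4 * W ^+ 2 / D < H by rewrite ltr_pdivrMr.
have WM : W ^+ 2 / (4 * M) <= W ^+ 2 / D.
  by rewrite ler_wpM2l ?sqr_ge0// lef_pV2 ?posrE; lra.
have WD : 0 <= W ^+ 2 / D by rewrite divr_ge0 ?sqr_ge0// ltW.
(* [N] is the squared length of the part of [w] orthogonal to [p - q] and [p + q]; [T] is the
   squared length that the same part of [v] must have. *)
pose N := H - W ^+ 2 / D - W ^+ 2 / (4 * M).
have N0 : 0 < N by rewrite /N; lra.
pose T := 3 * D - D ^+ 2 / (4 * M).
have T0 : 0 < T.
  have : D ^+ 2 / (4 * M) <= D by rewrite ler_pdivrMr; nra.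
  by rewrite /T; lra.
(* With [m = (p + q) / 2] and [v = r w + s m + t a], the values of [s] and [t]
   are forced by [v.a = 0] and [v.p = D / 2], and that of [r] by [|v|^2 = 3 D];
   [s > 0] is the hypothesis [shallow]. *)
pose r := Num.sqrt (T / N).
have r0 : 0 <= r := sqrtr_ge0 _.
have rr : r ^+ 2 * N = T.
  by rewrite sqr_sqrtr ?divfK ?gt_eqF// divr_ge0// ltW.
have rW : r * W < D.
  have TN : T * W ^+ 2 < N * D ^+ 2.
    rewrite -subr_gt0 [ltRHS](_ : _ = D * (H * D - 4 * W ^+ 2)).
      by rewrite mulr_gt0// subr_gt0.
    by rewrite /T /N; field; apply/andP; split; lra.
  rewrite -ltr_sqr ?nnegrE ?mulr_ge0// ?(ltW D0)//.
  rewrite -(ltr_pM2l N0) exprMn; apply: le_lt_trans TN.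
  by rewrite -rr le_eqVlt; apply/orP; left; apply/eqP; ring.
pose m := 2^-1 *: (p + q).
pose s := (D - r * W) / (2 * M).
have s0 : 0 < s by rewrite divr_gt0; lra.
have wa : dot w a = - W by rewrite /a !dotE wp -/W; ring.
have wm : dot w m = W / 2 by rewrite /m !dotE wp -/W; field.
have ma : dot m a = 0 by rewrite /m /a !dotE pp qq (dotC q p); ring.
have mm : dot m m = M.
  by rewrite /M DE /m !dotE pp qq (dotC q p); field.
have mp : dot m p = M.
  by rewrite /M DE /m !dotE pp (dotC q p); field.
have ap : dot a p = D / 2.
  by rewrite DE /a !dotE pp (dotC q p); field.
have m0 x : A x -> 0 < dot m x.
  move=> Ax; have := diam_dot Ap Ax; have := diam_dot Aq Ax.
  by rewrite /m dotZl dotDl; lra.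
have M0 : M != 0 by rewrite gt_eqF//; lra.
have Dn0 : D != 0 by rewrite gt_eqF.
clearbody a m.
exists (r *: w + s *: m + (r * W / D) *: a), (- (r * W / D)); split.
- rewrite dotC !dotE wa ma -/D.
  by field.
- rewrite !dotE (dotC m w) (dotC a w) (dotC a m) wa wm ma mm -/D -/H.
  have -> : 3 * D = r ^+ 2 * N + D ^+ 2 / (4 * M) by rewrite rr /T; ring.
  by rewrite /N /s; field; apply/andP.
- rewrite dotC !dotE wp mp ap /s; field; apply/andP; split => //.
(* The choice of [c] cancels the [a] term of [v], leaving [r w + s m]. *)
- move=> x Ax; rewrite scaleNr addrK dotDl !dotZl.
  by rewrite ltr_wpDl ?mulr_ge0 ?wA// mulr_gt0 ?m0.
Qed.

Hypothesis A_closed : closed A.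

Lemma exists_farthest o : A o ->
  exists2 p, A p & forall x, A x -> dot o p <= dot o x.
Proof.
move=> Ao.
have cA : compact A.
  apply: bounded_closed_compact A_closed; exists 1; split; first exact: num_real.
  move=> r r1 x Ax; rewrite /Num.norm/= mx_normrE.
  apply/bigmax_leP; split=> [|[i j] _ /=]; first by lra.
  rewrite (ord1 i); apply: le_trans (ltW r1).
  rewrite -[leRHS]ger0_norm// -ler_sqr ?nnegrE// !real_normK ?num_real//.
  rewrite expr1n -(sphere_dot Ax) /dot (bigD1 j)//= expr2 lerDl.
  by apply: sumr_ge0 => l _; rewrite -expr2 sqr_ge0.
have co : {within A, continuous (dot o)}.
  exact/continuous_subspaceT/dot_continuous.
have [p] := EVT_min_rV (ex_intro _ o Ao) cA co.
rewrite inE => Ap pmin; exists p => // x Ax; apply: pmin; exact/mem_set.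
Qed.

End Sphere.

Theorem theorem2p1 (R : realType) (n : nat) (A : set 'rV[R]_n.+1) :
  (2 <= n)%N ->
  A `<=` @sphere R n ->
  closed A ->
  (0 < ediam A)%E -> (ediam A <= 1)%E ->
  exists f : 'M[R]_n.+1, f \in @SO R n.+1 /\
    [/\ A `&` act f A !=set0,
        A `&` act f (act f A) !=set0,
        act f A `&` act f (act f A) !=set0 &
        A `&` act f A `&` act f (act f A) = set0].
Proof.
move=> n2 AS Acl A0 A1.
have [ o [y [Ao Ay oy]]] : exists o y, [/\ A o, A y & o != y].
  have [_ [x Ax [y Ay <-]]] := ereal_sup_gt A0.
  rewrite lte_fin /Defs.edist enormE sqrtr_gt0 => xy.
  by exists x, y; split=> //; rewrite -subr_eq0 -dot_eq0 gt_eqF.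
have dot_lt1 x z : A x -> A z -> x != z -> dot x z < 1.
  move=> Ax Az; rewrite -subr_eq0 => /dot_gt0.
  by rewrite !dotE (dotC z x) !(sphere_dot AS)//; lra.
have [p Ap pmin] := exists_farthest AS Acl Ao.
have op1 : dot o p < 1.
  by rewrite (le_lt_trans (pmin _ Ay))// dot_lt1.
have op12 := diam_dot AS A1 Ao Ap.
have pp := sphere_dot AS Ap; have oo := sphere_dot AS Ao.
pose h := o - dot o p *: p.
have hp : dot h p = 0 by rewrite /h !dotE pp; ring.
have ho : 0 < dot h o by rewrite /h !dotE oo (dotC p o); nra.
(* Since [p] is farthest from [o], [h.x >= o.p (1 - p.x) >= 0]. *)
have hA : nonneg_on A h.
  move=> x Ax; rewrite /h !dotE; have := pmin x Ax.
  have := dot_CauchySchwarz p x; rewrite pp (sphere_dot AS Ax).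
  by have := diam_dot AS A1 Ap Ax; nra.
clearbody h.
(* Turning [h] around [p] takes a third dimension, hence [2 <= n]. *)
have [g0 [g00 g0p g0h]] := @orthogonal_pair_exists R n.+1 p h n2.
pose g := Num.sqrt (dot h h / dot g0 g0) *: g0.
have gg : dot g g = dot h h.
  rewrite /g !dotE mulrA -expr2 sqr_sqrtr ?divr_ge0 ?dot_ge0// divfK//.
  by rewrite dot_eq0.
have [||w [q [wA Aq wp shallow]]] := shallow_support hp _ _ gg hA Ao ho.
- by rewrite /g dotZl g0p mulr0.
- by rewrite /g dotZl g0h mulr0.
have [v [c [av vv pv wpos]]] := rotation_plane AS A1 Ap Aq wA wp shallow.
have pq : p - q != 0.
  apply/eqP => pq; move: shallow; rewrite pq -[0](scale0r 0) dotZl mul0r mulr0.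
  by have := sqr_ge0 (dot w q); lra.
set M := rot (p - q) v.
have MMt : M *m M^T = 1%:M := rot_orthogonal pq av vv.
have MM : M *m M = M^T := rot_square pq av vv.
have pM : p *m M = q.
  rewrite mulmx_rot pv; have -> : dot p (p - q) = dot (p - q) (p - q) / 2.
    by rewrite !dotE pp (sphere_dot AS Aq) (dotC q p); field.
  have : dot (p - q) (p - q) != 0 by rewrite dot_eq0.
  move: (dot _ _) => D D0.
  by apply/rowP => j; rewrite !mxE; field.
exists M; split; first by rewrite inE; split=> //; exact: det_rot pq av vv.
have fAq : act M A q by exists p.
(* The three common points are [q = f p], then [p = f (f q)] because [f] has order 3, then [f q]. *)
split.
- by exists q.
- exists p; split=> //; exists (q *m M); first by exists q.
  by rewrite -pM -!mulmxA MM MMt mulmx1.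
- by exists (q *m M); split; exists q.
apply/seteqP; split=> // y' [[Ay' [x1 Ax1 x1M]] [_ [x2 Ax2 <-] x2MM]].
(* Cancelling [M] shows that the orbit [x2], [x1], [y'] lies in [A], where three positive products
   would sum to 0. *)
have x2M : x2 *m M = x1.
  by rewrite -[LHS]mulmx1 -[RHS]mulmx1 -MMt !mulmxA x2MM x1M.
have := dot_rot_orbit pq av vv c x2.
rewrite -/M -MM mulmxA x2MM x2M.
by have := wpos _ Ax2; have := wpos _ Ax1; have := wpos _ Ay'; lra.
Qed.
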